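(* Consider the instrumental-variables model described in the context, with first-stage coefficient $\pi_1 \neq 0$, and suppose that either Assumption A or Assumption B holds. Let $(\lambda_n)$ be a sequence of penalty parameters with $\lambda_n = o(n)$, i.e. $\lambda_n/n \to 0$. Then the ridge IV estimator \[ \hat\beta_{\text{ridge}} = \frac{\sum_{i=1}^n (Y_i-\bar Y)(Z_i-\bar Z)}{\sum_{i=1}^n (D_i-\bar D)(Z_i-\bar Z) + \lambda_n} \] is consistent: $\hat\beta_{\text{ridge}} \xrightarrow{p} \beta_1$ as $n\to\infty$.
   Context: Data model: for each sample size $n$, observations $(Y_i,D_i,Z_i)$, $i=1,\dots,n$, satisfy $Y_i=\beta_0+\beta_1 D_i+\epsilon_i$ and $D_i=\pi_0+\pi_1 Z_i+\eta_i$, where the error pairs $(\epsilon_i,\eta_i)$ are i.i.d. across $i$ with mean zero, $\mathrm{Var}(\epsilon_i)=\sigma_\epsilon^2<\infty$, $\mathrm{Var}(\eta_i)=\sigma_\eta^2<\infty$ and $\mathrm{Cov}(\epsilon_i,\eta_i)=\sigma_{\epsilon\eta}$ (the errors may be correlated, i.e. $D_i$ is endogenous), and the instruments $Z_i$ are independent of the errors. Bars denote sample means, e.g. $\bar Y=\frac1n\sum_i Y_i$. The penalty $\lambda_n$ is a deterministic sequence of nonnegative reals. Assumption A (instruments as constants): the analysis is conditional on the instruments, so $Z_1,Z_2,\dots$ is a deterministic real sequence, with $\frac1n\sum_{i=1}^n Z_i^2\to 1$ and $\frac1n\sum_{i=1}^n Z_i \to 0$. Assumption B (stochastic instruments): the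 $Z_i$ are i.i.d. random variables, independent of the errors, with $\mathrm{Var}(Z_i)=1$ and finite fourth moment $m_4=E[Z_i^4]$. *)

(* Defs.v *)
From HB Require Import structures.
From mathcomp Require Import all_boot all_order all_algebra.
From mathcomp Require Import all_classical all_reals all_analysis.
Set Implicit Arguments. Unset Strict Implicit. Unset Printing Implicit Defensive.
Import Order.TTheory GRing.Theory Num.Theory.
Import numFieldNormedType.Exports.
Local Open Scope classical_set_scope.
Local Open Scope ring_scope.

Section defs.
Context (d : measure_display) (T : measurableType d) (R : realType) (P : probability T R).

Definition mutual_indep (F : nat -> set (set T)) : Prop :=
  forall (s : seq nat) (A : nat -> set T), uniq s ->
    (forall j, j \in s -> F j (A j)) ->
    P (\bigcap_(j in [set` s]) A j) = (\prod_(j <- s) P (A j))%E.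

Definition indep2 (F G : set (set T)) : Prop :=
  forall A B, F A -> G B -> P (A `&` B) = (P A * P B)%E.

Definition sigmaR (X : T -> R) : set (set T) :=
  [set X @^-1` B | B in [set B : set R | measurable B]].

Definition sigmaR2 (X : T -> R * R) : set (set T) :=
  [set X @^-1` B | B in [set B : set (R * R) | measurable B]].

Definition sigmaR3 (X : T -> R * (R * R)) : set (set T) :=
  [set X @^-1` B | B in [set B : set (R * (R * R)) | measurable B]].

Definition cvg_in_prob (X : nat -> T -> R) (c : R) : Prop :=
  forall e : R, 0 < e ->
    (fun n => P [set w | e <= `|X n w - c|]) @ \oo --> 0%E.

End defs.

Definition smean (R : realType) (x : nat -> R) (n : nat) : R :=
  n%:R^-1 * \sum_(i < n) x i.

Definition ridge_iv (R : realType) (Y D Z : nat -> R) (lam : R) (n : nat) : R :=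
  (\sum_(i < n) (Y i - smean Y n) * (Z i - smean Z n)) /
  (\sum_(i < n) (D i - smean D n) * (Z i - smean Z n) + lam).

(* Main.v *)
(** Write s_xz for the sample covariance of x and z. Substituting the two model
equations gives, with A_n = pi1 s_ZZ + s_etaZ,
<<
  ridge = (beta1 A_n + s_epsZ) / (A_n + lam_n / n).
>>
It is therefore enough that s_ZZ tends to a nonzero constant and that s_epsZ and
s_etaZ tend to 0 in probability; the limit is then beta1. Chebyshev's inequality,
applied to means of pairwise uncorrelated variables, gives this under both
assumptions. Under Assumption A the terms z_i eps_i are uncorrelated, and the
variance of their mean is sigma^2 / n times the mean of z_i^2. Under Assumption B
sample covariances converge to the population ones, which are 1 for Z with itself
and 0 for Z with an independent error; the fourth moment of Z is what puts Z^2 in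
L^2. *)

Require Import Defs.
From HB Require Import structures.
From mathcomp Require Import all_boot all_order all_algebra.
From mathcomp Require Import all_classical all_reals all_analysis.
From mathcomp Require Import measurable_realfun ring.
Import Order.TTheory GRing.Theory Num.Theory.
Import numFieldNormedType.Exports.
Local Open Scope classical_set_scope.
Local Open Scope ring_scope.
Set Implicit Arguments. Unset Strict Implicit. Unset Printing Implicit Defensive.

Section measurability_and_integrability.
Context (d : measure_display) (T : measurableType d) (R : realType).
Implicit Types X Y : T -> R.

Definition to_mfun (d' : measure_display) (V : measurableType d') (f : T -> V)
    (mf : measurable_fun setT f) : {mfun T >-> V} :=
  mfun_Sub (mem_set mf).

Lemma measurable_normr_powR (p : R) : measurable_fun setT (fun x : R => `|x| `^ p).
Proof.
by apply: (measurableT_comp (measurable_powR p)); exact: normr_measurable.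
Qed.

Lemma measurable_funV (D : set T) X :
  measurable_fun D X -> measurable_fun D (fun w => (X w)^-1).
Proof.
move=> mX.
(* This reduces inversion to [powR], which the library proves measurable. *)
have -> : (fun w => (X w)^-1) = (fun w => X w * (`|X w| `^ (-1)) ^+ 2).
  apply/funext => w; rewrite powR_inv1 ?normr_ge0// exprVn real_normK ?num_real//.
  have [->|Xw0] := eqVneq (X w) 0; first by rewrite invr0 mul0r.
  by rewrite expr2 invfM mulrA mulfV// mul1r.
apply: measurable_funM => //; apply: measurable_funX.
by apply: (measurableT_comp (measurable_normr_powR _)).
Qed.

Lemma measurable_dist_ge X (c e : R) : measurable_fun setT X ->
  measurable [set w | e <= `|X w - c|].
Proof.
move=> mX; rewrite -[X in measurable X]setTI; apply: measurable_fun_le => //.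
by apply: measurableT_comp => //; exact: measurable_funB.
Qed.

Lemma Lfun_measurable (mu : {measure set T -> \bar R}) (p : \bar R) X :
  X \in Lfun mu p -> measurable_fun setT X.
Proof. by move=> /andP[+ _]; rewrite inE. Qed.

Lemma Lfun_lty (mu : {measure set T -> \bar R}) (p : R) X : 0 < p ->
  measurable_fun setT X ->
  X \in Lfun mu p%:E <-> (\int[mu]_w (`|X w| `^ p)%:E < +oo)%E.
Proof.
move=> p0 mX; split=> [/andP[_]|Xp].
- rewrite inE/= /finite_norm unlock/=; apply: lty_poweRy.
  by rewrite invr_eq0 gt_eqF.
- by apply/andP; split; rewrite inE//= /finite_norm unlock /=; exact: poweR_lty.
Qed.

Lemma integrable_exp_Lfun (mu : {measure set T -> \bar R}) (n : nat) X :
  (0 < n)%N -> measurable_fun setT X ->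
  mu.-integrable setT (fun w => (X w ^+ n)%:E) -> X \in Lfun mu n%:R%:E.
Proof.
move=> n0 mX /integrableP[_ Xn]; apply/Lfun_lty => //; first by rewrite ltr0n.
move: Xn; congr (_ < _)%E; apply: eq_integral => w _.
by rewrite powR_mulrn// -normrX.
Qed.

Lemma Lfun_sqr (mu : {measure set T -> \bar R}) (p : R) X : 0 < p ->
  X \in Lfun mu (2 * p)%:E -> X \* X \in Lfun mu p%:E.
Proof.
move=> p0 X2p; have mX := Lfun_measurable X2p.
apply/Lfun_lty => //; first exact: measurable_funM.
move/Lfun_lty: X2p => /(_ _ mX)/wrap[]; first by rewrite mulr_gt0.
congr (_ < _)%E; apply: eq_integral => w _ /=.
by rewrite normrM powRM// mulr2n mulrDl !mul1r powRD// gt_eqF ?addr_gt0.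
Qed.

Lemma Lfun2_Lfun1 (P : probability T R) X : X \in Lfun P 2%:E -> X \in Lfun P 1.
Proof. by apply: Lfun_subset12; exact: fin_num_measure. Qed.

End measurability_and_integrability.

Section convergence_in_probability.
Context (d : measure_display) (T : measurableType d) (R : realType)
  (P : probability T R).

(* Measurability is part of the notion because [P] is only meaningful (monotone,
   subadditive) on measurable sets. *)
Definition consistent (X : nat -> T -> R) (c : R) :=
  (forall n, measurable_fun setT (X n)) /\ cvg_in_prob P X c.

Lemma consistent_continuous2 (f : R * R -> R) (X Y : nat -> T -> R) (a b : R) :
  f p @[p --> (a, b)] --> f (a, b) ->
  (forall n, measurable_fun setT (fun w => f (X n w, Y n w))) ->
  consistent X a -> consistent Y b ->
  consistent (fun n w => f (X n w, Y n w)) (f (a, b)).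
Proof.
move=> fab mf [mX Xa] [mY Yb]; split => // e e0.
have /fab [[U V] /= [/nbhs_ballP[r r0 rU] /nbhs_ballP[s s0 sV]] UV] :
  nbhs (f (a, b)) (ball (f (a, b)) e) by exact: nbhsx_ballx.
have XY0 : (P [set w | (r <= `|X n w - a|)%R] +
    P [set w | (s <= `|Y n w - b|)%R])%E @[n --> \oo] --> 0%E.
  rewrite -[X in _ --> X]adde0; apply: cvgeD => //; [exact: Xa|exact: Yb].
apply: (squeeze_cvge (f := cst 0%E)); [|exact: cvg_cst|exact: XY0].
apply: nearW => n; rewrite measure_ge0/=.
have mXr := measurable_dist_ge a r (mX n).
have mYs := measurable_dist_ge b s (mY n).
apply: (le_trans _ (measureU2 _ mXr mYs)).
apply: le_measure; rewrite ?inE; [exact: measurable_dist_ge|exact: measurableU|].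
move=> w /= fe; have [Xr|Xr] := leP r `|X n w - a|; first by left.
have [Ys|Ys] := leP s `|Y n w - b|; first by right.
have /= := UV (X n w, Y n w).
rewrite /ball/= distrC ltNge fe => /(_ _)/wrap[|//]; split => /=.
- by apply: rU; rewrite /ball/= distrC.
- by apply: sV; rewrite /ball/= distrC.
Qed.

Lemma consistentD (X Y : nat -> T -> R) (a b : R) :
  consistent X a -> consistent Y b ->
  consistent (fun n w => X n w + Y n w) (a + b).
Proof.
move=> Xa Yb; apply: (consistent_continuous2 (f := fun p => p.1 + p.2)) => //.
- by apply: cvgD; [exact: cvg_fst|exact: cvg_snd].
- by move=> n; apply: measurable_funD; [exact: Xa.1|exact: Yb.1].
Qed.

Lemma consistentB (X Y : nat -> T -> R) (a b : R) :
  consistent X a -> consistent Y b ->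
  consistent (fun n w => X n w - Y n w) (a - b).
Proof.
move=> Xa Yb; apply: (consistent_continuous2 (f := fun p => p.1 - p.2)) => //.
- by apply: cvgB; [exact: cvg_fst|exact: cvg_snd].
- by move=> n; apply: measurable_funB; [exact: Xa.1|exact: Yb.1].
Qed.

Lemma consistentM (X Y : nat -> T -> R) (a b : R) :
  consistent X a -> consistent Y b ->
  consistent (fun n w => X n w * Y n w) (a * b).
Proof.
move=> Xa Yb; apply: (consistent_continuous2 (f := fun p => p.1 * p.2)) => //.
- by apply: cvgM; [exact: cvg_fst|exact: cvg_snd].
- by move=> n; apply: measurable_funM; [exact: Xa.1|exact: Yb.1].
Qed.

Lemma consistent_div (X Y : nat -> T -> R) (a b : R) : b != 0 ->
  consistent X a -> consistent Y b ->
  consistent (fun n w => X n w / Y n w) (a / b).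
Proof.
move=> b0 Xa Yb; apply: (consistent_continuous2 (f := fun p => p.1 / p.2)) => //.
- by apply: cvgM; [exact: cvg_fst|apply: cvgV => //; exact: cvg_snd].
- move=> n; apply: measurable_funM; first exact: Xa.1.
  by apply: measurable_funV; exact: Yb.1.
Qed.

Lemma consistent_deterministic (u : nat -> R) (c : R) :
  u n @[n --> \oo] --> c -> consistent (fun n _ => u n) c.
Proof.
move=> uc; split=> [n|e e0]; first exact: measurable_cst.
apply: cvg_near_cst; have /cvgrPdist_lt/(_ _ e0) := uc.
apply: filterS => n cun; rewrite -(measure0 P); congr (P _).
by rewrite -subset0 => w /=; rewrite distrC leNgt cun.
Qed.

Lemma consistent_cst (c : R) : consistent (fun _ _ => c) c.
Proof. by apply: consistent_deterministic; exact: cvg_cst. Qed.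

Lemma consistent_vanishing_variance (S : nat -> T -> R) (m v : nat -> R) (c : R) :
  (forall n, S n \in Lfun P 2%:E) ->
  (forall n, 'E_P[S n] = (m n)%:E)%E -> (forall n, 'V_P[S n] = (v n)%:E)%E ->
  m n @[n --> \oo] --> c -> v n @[n --> \oo] --> 0 -> consistent S c.
Proof.
move=> S2 Sm Sv mc v0.
have mS n : measurable_fun setT (S n) by exact: Lfun_measurable (S2 n).
suff Sm0 : consistent (fun n w => S n w - m n) 0.
  have := consistentD Sm0 (consistent_deterministic mc); rewrite add0r.
  by congr consistent; apply/funext => n; apply/funext => w; rewrite subrK.
split=> [n|e e0]; first exact: measurable_funB.
apply: (squeeze_cvge (f := cst 0%E) (h := fun n => (e ^- 2 * v n)%:E)).
- apply: nearW => n; rewrite measure_ge0/=.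
  have := chebyshev (to_mfun (mS n) : {RV P >-> R}) e0.
  by rewrite /= Sm Sv/= -EFinM; under eq_set do rewrite -[X in `|X|]subr0.
- exact: cvg_cst.
- apply: cvg_EFin; first exact: nearW.
  by rewrite -[X in _ --> X](mulr0 (e ^- 2)); apply: cvgM => //; exact: cvg_cst.
Qed.

End convergence_in_probability.

Section identical_distribution.
Context (d : measure_display) (T : measurableType d) (R : realType)
  (P : probability T R).

Definition identically_distributed (d' : measure_display) (V : measurableType d')
    (X Y : T -> V) :=
  forall B, measurable B -> P (X @^-1` B) = P (Y @^-1` B).

Lemma identically_distributed_comp (d1 d2 : measure_display)
    (V : measurableType d1) (U : measurableType d2) (f : V -> U) (X Y : T -> V) :
  measurable_fun setT f -> identically_distributed X Y ->
  identically_distributed (f \o X) (f \o Y).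
Proof.
move=> mf XY B mB; apply: (XY (f @^-1` B)).
by rewrite -[X in measurable X]setTI; exact: mf.
Qed.

Lemma ge0_integral_identically_distributed (d' : measure_display)
    (V : measurableType d') (X Y : T -> V) (f : V -> \bar R) :
  measurable_fun setT X -> measurable_fun setT Y -> measurable_fun setT f ->
  (forall x, 0 <= f x)%E -> identically_distributed X Y ->
  (\int[P]_w f (X w) = \int[P]_w f (Y w))%E.
Proof.
move=> mX mY mf f0 XY.
rewrite -(ge0_integral_distribution (to_mfun mX) mf f0).
rewrite -(ge0_integral_distribution (to_mfun mY) mf f0).
by apply: eq_measure_integral => B mB _; exact: XY.
Qed.

Section real_valued.
Variables X Y : T -> R.
Hypotheses (mX : measurable_fun setT X) (mY : measurable_fun setT Y).
Hypothesis XY : identically_distributed X Y.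

Lemma expectation_identically_distributed : ('E_P[X] = 'E_P[Y])%E.
Proof.
have mEFin : measurable_fun setT (@EFin R) by exact/measurable_EFinP.
have posE Z : ((fun w : T => (Z w)%:E) ^\+ = (@EFin R) ^\+ \o Z)%E.
  exact: funepos_comp.
have negE Z : ((fun w : T => (Z w)%:E) ^\- = (@EFin R) ^\- \o Z)%E.
  exact: funeneg_comp.
rewrite unlock [LHS]integralE [RHS]integralE !posE !negE; congr (_ - _)%E.
- apply: (ge0_integral_identically_distributed mX mY _ _ XY) => //.
  exact: measurable_funepos.
- apply: (ge0_integral_identically_distributed mX mY _ _ XY) => //.
  exact: measurable_funeneg.
Qed.

Lemma Lfun_identically_distributed (p : R) : 0 < p ->
  Y \in Lfun P p%:E -> X \in Lfun P p%:E.
Proof.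
move=> p0 /(Lfun_lty P p0 mY) Yp; apply/Lfun_lty => //.
have mabsp : measurable_fun setT (fun x : R => (`|x| `^ p)%:E).
  by apply/measurable_EFinP; exact: measurable_normr_powR.
by rewrite (ge0_integral_identically_distributed mX mY mabsp).
Qed.

End real_valued.

Lemma variance_identically_distributed (X Y : T -> R) :
  measurable_fun setT X -> Y \in Lfun P 2%:E -> identically_distributed X Y ->
  ('V_P[X] = 'V_P[Y])%E.
Proof.
move=> mX Y2 XY; have mY := Lfun_measurable Y2.
have X2 := Lfun_identically_distributed mX mY XY (ltr0n R 2) Y2.
have msqr : measurable_fun setT (fun x : R => x ^+ 2) by exact: measurable_funX.
rewrite !varianceE// (expectation_identically_distributed mX mY XY).
congr (_ - _)%E; apply: expectation_identically_distributed.
- exact: (measurableT_comp msqr mX).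
- exact: (measurableT_comp msqr mY).
- exact: (identically_distributed_comp msqr XY).
Qed.

End identical_distribution.

Section independence.
Context (d : measure_display) (T : measurableType d) (R : realType)
  (P : probability T R).

(* [sigmaR], [sigmaR2] and [sigmaR3] are instances of this, up to conversion. *)
Definition sigmaRV (d' : measure_display) (V : measurableType d') (X : T -> V) :
    set (set T) :=
  [set X @^-1` B | B in [set B : set V | measurable B]].

Lemma sigmaRV_comp (d1 d2 : measure_display) (V : measurableType d1)
    (U : measurableType d2) (f : V -> U) (X : T -> V) :
  measurable_fun setT f -> sigmaRV (f \o X) `<=` sigmaRV X.
Proof.
move=> mf _ [B mB <-]; exists (f @^-1` B) => //=.
by rewrite -[X in measurable X]setTI; exact: mf.
Qed.

Lemma indep2_sub (F F' G G' : set (set T)) :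
  F' `<=` F -> G' `<=` G -> indep2 P F G -> indep2 P F' G'.
Proof. by move=> F'F G'G FG A B /F'F FA /G'G GB; exact: FG. Qed.

Lemma indep2C (F G : set (set T)) : indep2 P F G -> indep2 P G F.
Proof. by move=> FG A B GA FB; rewrite setIC muleC; exact: FG. Qed.

Lemma mutual_indep_sub (F F' : nat -> set (set T)) :
  (forall i, F' i `<=` F i) -> mutual_indep P F -> mutual_indep P F'.
Proof. by move=> F'F indepF s A us sA; apply: indepF => // j /sA /F'F. Qed.

Lemma mutual_indep_indep2 (F : nat -> set (set T)) (i j : nat) :
  mutual_indep P F -> i != j -> indep2 P (F i) (F j).
Proof.
move=> indepF ij A B FA FB; pose C k := if k == i then A else B.
have Ci : C i = A by rewrite /C eqxx.
have Cj : C j = B by rewrite /C eq_sym (negbTE ij).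
have := indepF [:: i; j] C; rewrite bigcap_seq !big_cons !big_nil mule1 setIT Ci Cj.
apply=> [|k]; first by rewrite /= inE andbT.
by rewrite !inE => /orP[] /eqP->; rewrite ?Ci ?Cj.
Qed.

Definition iid (d' : measure_display) (V : measurableType d') (X : nat -> T -> V) :=
  [/\ forall i, measurable_fun setT (X i),
      mutual_indep P (fun i => sigmaRV (X i)) &
      forall i, identically_distributed P (X i) (X 0)].

Lemma iid_comp (d1 d2 : measure_display) (V : measurableType d1)
    (U : measurableType d2) (f : V -> U) (X : nat -> T -> V) :
  measurable_fun setT f -> iid X -> iid (fun i => f \o X i).
Proof.
move=> mf [mX indepX idX]; split=> [i| |i].
- exact: measurableT_comp.
- by apply: mutual_indep_sub indepX => i; exact: sigmaRV_comp.
- exact: identically_distributed_comp.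
Qed.

End independence.

Section product_of_independent_variables.
Context (d d1 d2 : measure_display) (T : measurableType d) (V1 : measurableType d1)
  (V2 : measurableType d2) (R : realType) (P : probability T R).

Lemma indep2_distribution_pair (X : T -> V1) (Y : T -> V2)
    (mX : measurable_fun setT X) (mY : measurable_fun setT Y) :
  indep2 P (sigmaRV X) (sigmaRV Y) ->
  forall A, measurable A ->
    (distribution P (to_mfun mX) \x distribution P (to_mfun mY))%E A =
    distribution P (to_mfun (measurable_fun_pair mX mY)) A.
Proof.
move=> indepXY; apply: product_measure_unique => B C mB mC.
by rewrite /distribution /pushforward /= -indepXY; [|by exists B|by exists C].
Qed.

Lemma ge0_integral_indep2M (X : T -> V1) (Y : T -> V2) (f : V1 -> \bar R)
    (g : V2 -> \bar R) :
  measurable_fun setT X -> measurable_fun setT Y ->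
  indep2 P (sigmaRV X) (sigmaRV Y) ->
  measurable_fun setT f -> measurable_fun setT g ->
  (forall x, 0 <= f x)%E -> (forall y, 0 <= g y)%E ->
  (\int[P]_w (f (X w) * g (Y w)) = \int[P]_w f (X w) * \int[P]_w g (Y w))%E.
Proof.
move=> mX mY indepXY mf mg f0 g0.
have prodE := indep2_distribution_pair mX mY indepXY.
pose h (p : V1 * V2) := (f p.1 * g p.2)%E.
have mh : measurable_fun setT h.
  apply: emeasurable_funM; first exact: measurableT_comp.
  by apply: measurableT_comp => //; exact: measurable_snd.
have h0 p : (0 <= h p)%E by exact: mule_ge0.
rewrite -(ge0_integral_distribution (to_mfun (measurable_fun_pair mX mY)) mh h0).
rewrite -(eq_measure_integral _ (fun A mA _ => prodE A mA)).
rewrite fubini_tonelli1// /fubini_F /h/=.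
under eq_integral do rewrite ge0_integralZl//.
rewrite ge0_integralZr//; last exact: integral_ge0.
by rewrite !ge0_integral_distribution.
Qed.

End product_of_independent_variables.

Section independent_real_variables.
Context (d : measure_display) (T : measurableType d) (R : realType)
  (P : probability T R).
Variables X Y : T -> R.
Hypothesis indepXY : indep2 P (sigmaRV X) (sigmaRV Y).

Lemma indep2_LfunM (p : R) : 0 < p ->
  X \in Lfun P p%:E -> Y \in Lfun P p%:E -> X \* Y \in Lfun P p%:E.
Proof.
move=> p0 Xp Yp; have mX := Lfun_measurable Xp; have mY := Lfun_measurable Yp.
apply/Lfun_lty => //; first exact: measurable_funM.
have mabsp : measurable_fun setT (fun x : R => (`|x| `^ p)%:E).
  by apply/measurable_EFinP; exact: measurable_normr_powR.
under eq_integral do rewrite /= normrM powRM// EFinM.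
rewrite (ge0_integral_indep2M mX mY indepXY mabsp mabsp)//.
apply: lte_mul_pinfty; [exact: integral_ge0| |exact/(Lfun_lty P p0 mY)].
rewrite ge0_fin_numE; [exact/(Lfun_lty P p0 mX)|exact: integral_ge0].
Qed.

Lemma indep2_expectationM : X \in Lfun P 1 -> Y \in Lfun P 1 ->
  ('E_P[X \* Y] = 'E_P[X] * 'E_P[Y])%E.
Proof.
move=> X1 Y1; have mX := Lfun_measurable X1; have mY := Lfun_measurable Y1.
pose XY : {RV P >-> (R * R)%type} := to_mfun (measurable_fun_pair mX mY).
have prodE := indep2_distribution_pair mX mY indepXY.
pose f (p : R * R) := (p.1 * p.2)%:E.
have mf : measurable_fun setT f by apply/measurable_EFinP; exact: measurable_funM.
have int_fXY : P.-integrable setT (f \o XY).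
  by apply/(Lfun1_integrable P (X \* Y)); exact: indep2_LfunM.
have intX : (distribution P (to_mfun mX)).-integrable setT EFin.
  by apply: integrable_pushforward => //; exact/Lfun1_integrable.
have intY : (distribution P (to_mfun mY)).-integrable setT EFin.
  by apply: integrable_pushforward => //; exact/Lfun1_integrable.
have int_f_prod : (distribution P (to_mfun mX) \x
    distribution P (to_mfun mY))%E.-integrable setT f.
  have /integrableP[_] : (distribution P XY).-integrable setT f.
    exact: integrable_pushforward.
  move=> fXY_lty; apply/integrableP; split=> //; move: fXY_lty; congr (_ < _)%E.
  by apply: eq_measure_integral => A mA _; exact/esym/prodE.
rewrite unlock -(integral_distribution (X := XY) mf int_fXY).
rewrite -(eq_measure_integral _ (fun A mA _ => prodE A mA)).
rewrite -integral12_prod_meas1// /fubini_F /f/=.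
under eq_integral do rewrite (integralZl measurableT intY).
rewrite -(fineK (integrable_fin_num measurableT intY)) integralZr//.
rewrite (fineK (integrable_fin_num measurableT intY)).
rewrite (integral_distribution (X := to_mfun mX))//; last exact/Lfun1_integrable.
by rewrite (integral_distribution (X := to_mfun mY))//; exact/Lfun1_integrable.
Qed.

Lemma indep2_covariance0 : X \in Lfun P 1 -> Y \in Lfun P 1 ->
  covariance P X Y = 0%E.
Proof.
move=> X1 Y1; have XY1 : X \* Y \in Lfun P 1 by exact: indep2_LfunM.
rewrite covarianceE// [X in (X - _)%E]indep2_expectationM// subee//.
by rewrite fin_numM// expectation_fin_num.
Qed.

End independent_real_variables.

Lemma smeanZ (R : realType) (k : R) (x : nat -> R) n :
  smean (fun i => k * x i) n = k * smean x n.
Proof. by rewrite /smean -mulr_sumr mulrCA. Qed.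

Section law_of_large_numbers.
Context (d : measure_display) (T : measurableType d) (R : realType)
  (P : probability T R).
Implicit Type X : nat -> T -> R.

Lemma Lfun_sum X n : (forall i, X i \in Lfun P 2%:E) ->
  \sum_(i < n) X i \in Lfun P 2%:E.
Proof. by move=> X2; apply: rpred_sum => // *; rewrite ?lee1n. Qed.

Lemma covariance_suml X (Y : T -> R) n :
  (forall i, X i \in Lfun P 2%:E) -> Y \in Lfun P 2%:E ->
  (covariance P (\sum_(i < n) X i)%R Y = \sum_(i < n) covariance P (X i) Y)%E.
Proof.
move=> X2 Y2; elim: n => [|n IH]; first by rewrite !big_ord0 covariance_cst_l.
by rewrite !big_ord_recr/= covarianceDl ?IH//; exact: Lfun_sum.
Qed.

Lemma variance_sum_uncorrelated X n :
  (forall i, X i \in Lfun P 2%:E) ->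
  (forall i j, i != j -> covariance P (X i) (X j) = 0%E) ->
  ('V_P[(\sum_(i < n) X i)%R] = \sum_(i < n) 'V_P[X i])%E.
Proof.
move=> X2 Xuncor; elim: n => [|n IH]; first by rewrite !big_ord0 variance_cst.
rewrite !big_ord_recr/= varianceD ?IH//; last exact: Lfun_sum.
rewrite covariance_suml// [X in (2%:E * X)%E]big1 ?mule0 ?adde0// => i _.
by apply: Xuncor; rewrite neq_ltn ltn_ord.
Qed.

Lemma consistent_mean_uncorrelated X (m v : nat -> R) (c : R) :
  (forall i, X i \in Lfun P 2%:E) ->
  (forall i, 'E_P[X i] = (m i)%:E)%E -> (forall i, 'V_P[X i] = (v i)%:E)%E ->
  (forall i j, i != j -> covariance P (X i) (X j) = 0%E) ->
  smean m n @[n --> \oo] --> c -> smean v n / n%:R @[n --> \oo] --> 0 ->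
  consistent P (fun n w => smean (X ^~ w) n) c.
Proof.
move=> X2 Xm Xv Xuncor mc v0.
have meanE n : (fun w => smean (X ^~ w) n) = n%:R^-1 \o* \sum_(i < n) X i.
  by apply/funext => w; rewrite /smean/= fct_sumE mulrC.
apply: (consistent_vanishing_variance _ _ _ mc v0) => n; rewrite meanE.
- by apply: Lfun_scale; [rewrite ler1n|exact: Lfun_sum].
- rewrite expectationZl; last exact/Lfun2_Lfun1/Lfun_sum.
  rewrite /smean EFinM -sumEFin; congr (_ * _)%E.
  rewrite -(big_mkord xpredT X) -(big_map X xpredT id) expectation_sum.
    by rewrite big_map big_mkord; exact: eq_bigr.
  by move=> _ /mapP[i _ ->]; exact: Lfun2_Lfun1.
- rewrite varianceZ; last exact: Lfun_sum.
  rewrite variance_sum_uncorrelated// (eq_bigr (fun i : 'I_n => (v i)%:E))//.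
  by rewrite sumEFin -EFinM /smean expr2 mulrAC.
Qed.

Section iid_moments.
Variable X : nat -> T -> R.
Hypotheses (iidX : iid P X) (X02 : X 0 \in Lfun P 2%:E).

Let mX i : measurable_fun setT (X i). Proof. by have [] := iidX. Qed.

Let idX i : identically_distributed P (X i) (X 0). Proof. by have [] := iidX. Qed.

Lemma iid_Lfun2 i : X i \in Lfun P 2%:E.
Proof. exact: Lfun_identically_distributed X02. Qed.

Lemma iid_expectation i : ('E_P[X i] = 'E_P[X 0])%E.
Proof. exact: expectation_identically_distributed. Qed.

Lemma iid_variance i : ('V_P[X i] = 'V_P[X 0])%E.
Proof. exact: variance_identically_distributed. Qed.

Lemma iid_covariance0 i j : i != j -> covariance P (X i) (X j) = 0%E.
Proof.
move=> ij; have [_ indepX _] := iidX.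
apply: (indep2_covariance0 (mutual_indep_indep2 indepX ij)).
- exact/Lfun2_Lfun1/iid_Lfun2.
- exact/Lfun2_Lfun1/iid_Lfun2.
Qed.

End iid_moments.

Lemma consistent_iid_weighted_mean X (a : nat -> R) (alpha gamma : R) :
  iid P X -> X 0 \in Lfun P 2%:E ->
  smean a n @[n --> \oo] --> alpha ->
  smean (fun i => a i ^+ 2) n @[n --> \oo] --> gamma ->
  consistent P (fun n w => smean (fun i => X i w * a i) n) (fine 'E_P[X 0] * alpha).
Proof.
move=> iidX X02 a_alpha a2_gamma.
have X2 i : X i \in Lfun P 2%:E by exact: iid_Lfun2.
have X1 i : X i \in Lfun P 1 by exact: Lfun2_Lfun1.
have aX2 i : a i \o* X i \in Lfun P 2%:E by apply: Lfun_scale; rewrite ?ler1n.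
have a2n0 : smean (fun i => a i ^+ 2) n / n%:R @[n --> \oo] --> 0.
  rewrite -[X in _ --> X](mulr0 gamma); apply: cvgM => //.
  apply/gtr0_cvgV0; last exact: cvgr_idn.
  by exists 1%N => // n /= n0; rewrite ltr0n.
pose m := fine 'E_P[X 0]; pose v := fine 'V_P[X 0].
apply: (@consistent_mean_uncorrelated (fun i => a i \o* X i) (fun i => m * a i)
  (fun i => v * a i ^+ 2)).
- by [].
- move=> i; rewrite expectationZl// iid_expectation//.
  by rewrite -(fineK (expectation_fin_num (X1 0))) -EFinM mulrC.
- move=> i; rewrite varianceZ// iid_variance//.
  by rewrite -(fineK (variance_fin_num X02)) -EFinM mulrC.
- move=> i j ij.
  rewrite covarianceZl ?(Lfun2_Lfun1 (aX2 j)) ?(Lfun2_mul_Lfun1 (X2 i) (aX2 j))//.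
  by rewrite covarianceZr ?Lfun2_mul_Lfun1// iid_covariance0// !mule0.
- by under eq_fun do rewrite smeanZ; apply: cvgM => //; exact: cvg_cst.
- rewrite -[X in _ --> X](mulr0 v); under eq_fun do rewrite smeanZ -mulrA.
  by apply: cvgM => //; exact: cvg_cst.
Qed.

Lemma consistent_iid_mean X : iid P X -> X 0 \in Lfun P 2%:E ->
  consistent P (fun n w => smean (X ^~ w) n) (fine 'E_P[X 0]).
Proof.
move=> iidX X02.
have mean1 : smean (fun=> 1 : R) n @[n --> \oo] --> (1 : R).
  apply: cvg_near_cst; exists 1%N => // n /= n0.
  by rewrite /smean sumr_const card_ord mulVf// pnatr_eq0 -lt0n.
have mean1X : smean (fun=> 1 ^+ 2 : R) n @[n --> \oo] --> (1 : R).
  by under eq_fun do rewrite expr1n.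
have := consistent_iid_weighted_mean iidX X02 mean1 mean1X.
rewrite mulr1; congr consistent; apply/funext => n; apply/funext => w.
by congr smean; apply/funext => i; rewrite mulr1.
Qed.

End law_of_large_numbers.

Section sample_covariance.
Context (R : realType).
Implicit Types x y u z : nat -> R.

Definition scov x z (n : nat) : R :=
  smean (fun i => x i * z i) n - smean x n * smean z n.

Lemma scovE x z n :
  scov x z n = n%:R^-1 * \sum_(i < n) (x i - smean x n) * (z i - smean z n).
Proof.
have [->|n0] := eqVneq n 0%N; first by rewrite /scov /smean !big_ord0 !mulr0 subr0.
have nR : n%:R != 0 :> R by rewrite pnatr_eq0.
have -> : \sum_(i < n) (x i - smean x n) * (z i - smean z n) =
    \sum_(i < n) x i * z i - smean x n * \sum_(i < n) z i
    - smean z n * \sum_(i < n) x i + n%:R * (smean x n * smean z n).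
  have -> : n%:R * (smean x n * smean z n) = \sum_(i < n) smean x n * smean z n.
    by rewrite sumr_const card_ord mulr_natl.
  by rewrite !mulr_sumr -!sumrB -big_split/=; apply: eq_bigr => i _; ring.
by rewrite /scov /smean; field.
Qed.

Lemma scov_affine (b c : R) x y u z n : (forall i, x i = c + b * y i + u i) ->
  scov x z n = b * scov y z n + scov u z n.
Proof.
move=> xE; rewrite !scovE mulrCA -mulrDr; congr (_ * _).
rewrite mulr_sumr -big_split/=.
have [->|n0] := eqVneq n 0%N; first by rewrite !big_ord0.
have nR : n%:R != 0 :> R by rewrite pnatr_eq0.
have -> : smean x n = c + b * smean y n + smean u n.
  rewrite /smean; under eq_bigr do rewrite xE.
  rewrite !big_split/= -mulr_sumr.
  by rewrite sumr_const card_ord -mulr_natl; field.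
by apply: eq_bigr => i _; rewrite xE; ring.
Qed.

Lemma cvg_scov_diag z (mu q : R) :
  smean z n @[n --> \oo] --> mu ->
  smean (fun i => z i ^+ 2) n @[n --> \oo] --> q ->
  scov z z n @[n --> \oo] --> q - mu * mu.
Proof. by move=> zmu zq; apply: cvgB => //; exact: cvgM. Qed.

(* For [n = 0] both sides are [0], since [0 / x = 0] and [0^-1 = 0]. *)
Lemma ridge_ivE x y z lam n :
  ridge_iv y x z lam n = scov y z n / (scov x z n + lam / n%:R).
Proof.
rewrite /ridge_iv !scovE.
have [->|n0] := eqVneq n 0%N; first by rewrite !big_ord0 mulr0 !mul0r.
have nR : n%:R^-1 != 0 :> R by rewrite invr_eq0 pnatr_eq0.
by rewrite [lam / _]mulrC -mulrDr invfM mulrACA mulfV// mul1r.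
Qed.

End sample_covariance.

Section consistency_of_sample_covariance.
Context (d : measure_display) (T : measurableType d) (R : realType)
  (P : probability T R).
Implicit Types X Z : nat -> T -> R.

Lemma consistent_scov X Z (xz x z : R) :
  consistent P (fun n w => smean (fun i => X i w * Z i w) n) xz ->
  consistent P (fun n w => smean (X ^~ w) n) x ->
  consistent P (fun n w => smean (Z ^~ w) n) z ->
  consistent P (fun n w => scov (X ^~ w) (Z ^~ w) n) (xz - x * z).
Proof. by move=> XZ Xx Zz; apply: consistentB => //; exact: consistentM. Qed.

Lemma consistent_scov_deterministic X (z : nat -> R) (mu q : R) :
  iid P X -> X 0 \in Lfun P 2%:E ->
  smean z n @[n --> \oo] --> mu ->
  smean (fun i => z i ^+ 2) n @[n --> \oo] --> q ->
  consistent P (fun n w => scov (X ^~ w) z n) 0.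
Proof.
move=> iidX X02 zmu zq; rewrite -(subrr (fine 'E_P[X 0] * mu)).
apply: (consistent_scov (Z := fun i _ => z i)).
- exact: consistent_iid_weighted_mean zq.
- exact: consistent_iid_mean.
- exact: consistent_deterministic.
Qed.

Lemma consistent_scov_iid (d' : measure_display) (V : measurableType d')
    (W : nat -> T -> V) (f g : V -> R) :
  iid P W -> measurable_fun setT f -> measurable_fun setT g ->
  f \o W 0 \in Lfun P 2%:E -> g \o W 0 \in Lfun P 2%:E ->
  (f \* g) \o W 0 \in Lfun P 2%:E ->
  consistent P (fun n w => scov (fun i => f (W i w)) (fun i => g (W i w)) n)
    (fine (covariance P (f \o W 0) (g \o W 0))).
Proof.
move=> iidW mf mg f2 g2 fg2.
have Ef := expectation_fin_num (Lfun2_Lfun1 f2).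
have Eg := expectation_fin_num (Lfun2_Lfun1 g2).
have Efg := expectation_fin_num (Lfun2_Lfun1 fg2).
rewrite covarianceE ?Lfun2_Lfun1// fineB ?fin_numM// fineM//.
apply: (consistent_scov (X := fun i => f \o W i) (Z := fun i => g \o W i)).
- by apply: consistent_iid_mean fg2; exact: iid_comp (measurable_funM mf mg) iidW.
- by apply: consistent_iid_mean f2; exact: iid_comp iidW.
- by apply: consistent_iid_mean g2; exact: iid_comp iidW.
Qed.

Lemma consistent_scov_indep (d' : measure_display) (V : measurableType d')
    (U : nat -> T -> V) (f : V -> R) Z :
  iid P (fun i w => (Z i w, U i w)) -> indep2 P (sigmaRV (Z 0)) (sigmaRV (U 0)) ->
  measurable_fun setT f -> f \o U 0 \in Lfun P 2%:E -> Z 0 \in Lfun P 2%:E ->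
  consistent P (fun n w => scov (fun i => f (U i w)) (Z ^~ w) n) 0.
Proof.
move=> iidZU ZU mf f2 Z2.
have fUZ : indep2 P (sigmaRV (f \o U 0)) (sigmaRV (Z 0)).
  by apply: indep2C; apply: indep2_sub ZU => //; exact: sigmaRV_comp.
have mfsnd : measurable_fun setT (f \o snd : R * V -> R).
  by apply: measurableT_comp => //; exact: measurable_snd.
have fUZ2 := indep2_LfunM fUZ (ltr0n R 2) f2 Z2.
have := consistent_scov_iid iidZU mfsnd measurable_fst f2 Z2 fUZ2.
by rewrite (indep2_covariance0 fUZ) ?Lfun2_Lfun1.
Qed.

Lemma consistent_ridge (beta0 beta1 pi0 pi1 v : R) (eps eta Z Y D : nat -> T -> R)
    (lam : nat -> R) :
  pi1 != 0 -> v != 0 ->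
  (forall i w, Y i w = beta0 + beta1 * D i w + eps i w) ->
  (forall i w, D i w = pi0 + pi1 * Z i w + eta i w) ->
  lam n / n%:R @[n --> \oo] --> (0 : R) ->
  consistent P (fun n w => scov (Z ^~ w) (Z ^~ w) n) v ->
  consistent P (fun n w => scov (eps ^~ w) (Z ^~ w) n) 0 ->
  consistent P (fun n w => scov (eta ^~ w) (Z ^~ w) n) 0 ->
  consistent P (fun n w => ridge_iv (Y ^~ w) (D ^~ w) (Z ^~ w) (lam n) n) beta1.
Proof.
move=> pi1_neq0 v_neq0 YE DE lam0 sZZ sepsZ setaZ.
have sDZ : consistent P (fun n w => scov (D ^~ w) (Z ^~ w) n) (pi1 * v).
  under eq_fun do under eq_fun do rewrite (scov_affine _ _ (fun i => DE i _)).
  rewrite -[pi1 * v]addr0; apply: consistentD setaZ.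
  by apply: consistentM sZZ; exact: consistent_cst.
have sYZ : consistent P (fun n w => scov (Y ^~ w) (Z ^~ w) n) (beta1 * (pi1 * v)).
  under eq_fun do under eq_fun do rewrite (scov_affine _ _ (fun i => YE i _)).
  rewrite -[beta1 * _]addr0; apply: consistentD sepsZ.
  by apply: consistentM sDZ; exact: consistent_cst.
have sDZlam := consistentD sDZ (consistent_deterministic P lam0).
under eq_fun do under eq_fun do rewrite ridge_ivE.
rewrite -[beta1](@mulfK _ (pi1 * v)) ?mulf_neq0// -[X in _ / X]addr0.
by apply: consistent_div => //; rewrite addr0 mulf_neq0.
Qed.

End consistency_of_sample_covariance.

Theorem mainTheorem1 (d : measure_display) (T : measurableType d) (R : realType)
  (P : probability T R)
  (beta0 beta1 pi0 pi1 : R) (hpi1 : pi1 != 0)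
  (eps eta Z : nat -> {RV P >-> R}) (Y D : nat -> T -> R)
  (hY : forall i w, Y i w = beta0 + beta1 * D i w + eps i w)
  (hD : forall i w, D i w = pi0 + pi1 * Z i w + eta i w)
  (* the error pairs (eps_i, eta_i) are i.i.d. across i *)
  (herr_indep : mutual_indep P (fun i => sigmaR2 (fun w => (eps i w, eta i w))))
  (herr_ident : forall i (B : set (R * R)), measurable B ->
     P ((fun w => (eps i w, eta i w)) @^-1` B) = P ((fun w => (eps 0 w, eta 0 w)) @^-1` B))
  (* mean zero, finite variances (the covariance is arbitrary) *)
  (heps_L2 : P.-integrable setT (fun w => ((eps 0 w) ^+ 2)%:E))
  (heta_L2 : P.-integrable setT (fun w => ((eta 0 w) ^+ 2)%:E))
  (heps_mean : ('E_P[eps 0%N] = 0)%E) (heta_mean : ('E_P[eta 0%N] = 0)%E)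
  (* penalty *)
  (lam : nat -> R) (hlam_ge0 : forall n, 0 <= lam n)
  (hlam : (fun n => lam n / n%:R) @ \oo --> (0 : R))
  (* Assumption A or Assumption B *)
  (hZ :
    (exists z : nat -> R, (forall i w, Z i w = z i) /\
       (fun n => smean (fun i => z i ^+ 2) n) @ \oo --> (1 : R) /\
       (fun n => smean z n) @ \oo --> (0 : R))
    \/
    ((* triples (Z_i, eps_i, eta_i) independent across i and identically distributed,
        so that the Z_i are i.i.d. *)
     mutual_indep P (fun i => sigmaR3 (fun w => (Z i w, (eps i w, eta i w)))) /\
     (forall i (B : set (R * (R * R))), measurable B ->
        P ((fun w => (Z i w, (eps i w, eta i w))) @^-1` B) =
        P ((fun w => (Z 0 w, (eps 0 w, eta 0 w))) @^-1` B)) /\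
     (* instruments independent of the errors *)
     (forall i, indep2 P (sigmaR (Z i)) (sigmaR2 (fun w => (eps i w, eta i w)))) /\
     ('V_P[Z 0%N] = 1)%E /\
     P.-integrable setT (fun w => ((Z 0 w) ^+ 4)%:E))) :
  cvg_in_prob P
    (fun n w => ridge_iv (fun i => Y i w) (fun i => D i w) (fun i => Z i w) (lam n) n)
    beta1.
Proof.
have iid_err : iid P (fun i w => (eps i w, eta i w)).
  by split=> // i; exact: measurable_fun_pair.
have eps2 : (eps 0 : T -> R) \in Lfun P 2%:E by exact: integrable_exp_Lfun.
have eta2 : (eta 0 : T -> R) \in Lfun P 2%:E by exact: integrable_exp_Lfun.
case: hZ => [[z [Zz [z2 z1]]]|[indep_obs [ident_obs [indep_Z_err [varZ Z4]]]]].
- have ZE w : (fun i => Z i w) = z by apply/funext => i; exact: Zz.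
  apply: (consistent_ridge hpi1 (oner_neq0 R) hY hD hlam _ _ _).2;
    under eq_fun do under eq_fun do rewrite ZE.
  + apply: consistent_deterministic.
    by have := cvg_scov_diag z1 z2; rewrite mulr0 subr0.
  + exact: consistent_scov_deterministic (iid_comp measurable_fst iid_err) eps2 z1 z2.
  + exact: consistent_scov_deterministic (iid_comp measurable_snd iid_err) eta2 z1 z2.
- have iid_obs : iid P (fun i w => (Z i w, (eps i w, eta i w))).
    by split=> // i; do 2!apply: measurable_fun_pair => //.
  have ZL4 : (Z 0 : T -> R) \in Lfun P 4%:E by exact: integrable_exp_Lfun.
  have ZL2 : (Z 0 : T -> R) \in Lfun P 2%:E.
    by apply: Lfun_subset ZL4; rewrite ?lee1n ?fin_num_measure// lee_fin ler_nat.
  apply: (consistent_ridge hpi1 (oner_neq0 R) hY hD hlam _ _ _).2.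
  + have -> : 1 = fine (covariance P (Z 0) (Z 0)) by rewrite [covariance _ _ _]varZ.
    apply: (consistent_scov_iid iid_obs measurable_fst measurable_fst) => //.
    by apply: Lfun_sqr; rewrite -?natrM.
  + exact: consistent_scov_indep iid_obs (indep_Z_err 0) measurable_fst eps2 ZL2.
  + exact: consistent_scov_indep iid_obs (indep_Z_err 0) measurable_snd eta2 ZL2.
Qed.
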